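(* Let $X$ be a special involutive commutative two-valued group. Then $X$ is not coset, that is, $X$ is not isomorphic to any two-valued group of the form $G/\iota$, where $G$ is an ordinary (single-valued, not necessarily commutative) group and $\iota$ is an automorphism of $G$ such that $\iota^2=\mathrm{id}$.
   Context: For a set $X$, $\mathrm{Sym}^2(X)$ is the set of two-element multisets $[x,y]$ of elements of $X$. A two-valued group is a set $X$ with a map $*\colon X\times X\to \mathrm{Sym}^2(X)$, an element $e\in X$ and a map $x\mapsto x^{-1}$ such that: (associativity) $x*(y*z)=(x*y)*z$ as four-element multisets, where $x*[u,v]$ is the multiset union of $x*u$ and $x*v$, and similarly for $[u,v]*z$; (strong identity) $e*x=x*e=[x,x]$; (existence and uniqueness of inverse) $e$ belongs to each of $x*x^{-1}$ and $x^{-1}*x$, and if $e$ belongs to $x*y$ or to $y*x$ then $y=x^{-1}$. It is commutative if $x*y=y*x$ for all $x,y$, and involutive if $x^{-1}=x$ for all $x$. An isomorphism is a bijection $f$ such that $x*y=[z_1,z_2]$ implies $f(x)*f(y)=[f(z_1),f(z_2)]$. For an element $x$ of an involutive two-valued group there is a unique sequence $x^0=e,\ x^1=x,\ x^2,\ldots$ with $x*x^k=x^k*x=[x^{k-1},x^{k+1}]$ for all $k\ge1$; $\mathrm{ord}\,x$ is the least positive integer $k$ with $x^k=e$ ($\infty$ if none). An involutive commutative two-valued group is special if it contains elements $x,y$ with $\mathrm{ord}\,x>2$, $\mathrm{ord}\,y>2$ such that $x*y$ consists of two identical elements. Coset construction: $G/\iota$ denotes the set of orbits of $\iota$ on $G$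 with $\pi(g)*\pi(h)=[\pi(gh),\pi(g\iota(h))]$, identity $\pi(e)$ and inverse $\pi(g)^{-1}=\pi(g^{-1})$, where $\pi\colon G\to G/\iota$ is the projection. *)

(* Defs.v *)
From HB Require Import structures.
From mathcomp Require Import all_boot.
From mathcomp Require Import finmap multiset.
From mathcomp Require Import boolp.

Set Implicit Arguments.
Unset Strict Implicit.
Unset Printing Implicit Defensive.

Declare Scope two_valued_scope.
Delimit Scope two_valued_scope with tv.
Local Open Scope mset_scope.
Local Open Scope two_valued_scope.

Lemma mset2C (K : choiceType) (a b : K) : [mset a; b] = [mset b; a].
Proof. exact: msetDC. Qed.

Lemma mset_size2 (K : choiceType) (A : {mset K}) :
  size A = 2 -> exists a b, A = [mset a; b].
Proof.
case EA: (enum_mset A) => [|a [|b [|c s]]] // _.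
exists a, b; apply/msetP => x.
by rewrite -count_mem_mset EA mset1DE msetnE /= addn0 !(eq_sym x); case: (b == x).
Qed.

Lemma size_mset2 (K : choiceType) (a b : K) : size [mset a; b] = 2.
Proof.
have -> : [mset a; b] = seq_mset [:: a; b].
  apply/msetP => x; rewrite mset_seqE mset1DE msetnE /= addn0 !(eq_sym x).
  by case: (b == x).
by rewrite (perm_size (perm_eq_seq_mset _)).
Qed.

Lemma mset2_eq (K : choiceType) (a b c d : K) :
  [mset a; b] = [mset c; d] -> (c = a /\ d = b) \/ (c = b /\ d = a).
Proof.
move=> E; have : c \in [mset a; b] by rewrite E mset21.
rewrite in_mset2 => /orP[]/eqP Ec; [left|right]; split=> //.
  move: E; rewrite Ec => /(congr1 (fun A => A `\ a)); rewrite !msetD1K.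
  by move=> /msetP/(_ d); rewrite !msetnE eqxx; case: eqP.
move: E; rewrite Ec (mset2C a) => /(congr1 (fun A => A `\ b)); rewrite !msetD1K.
by move=> /msetP/(_ d); rewrite !msetnE eqxx; case: eqP.
Qed.

(* Elements of Sym^2(X) are the multisets of size 2.  In the associativity
   axiom, x * [u, v] is the sum (multiset union) of x * u and x * v. *)
Record twoValuedGroup := TwoValuedGroup {
  tvg_sort :> choiceType;
  tvg_mul : tvg_sort -> tvg_sort -> {mset tvg_sort};
  tvg_one : tvg_sort;
  tvg_inv : tvg_sort -> tvg_sort;
  tvg_size : forall x y, size (tvg_mul x y) = 2;
  tvg_mulA : forall x y z u v s t,
    tvg_mul y z = [mset u; v] -> tvg_mul x y = [mset s; t] ->
    tvg_mul x u `+` tvg_mul x v = tvg_mul s z `+` tvg_mul t z;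
  tvg_mul1x : forall x, tvg_mul tvg_one x = [mset x; x];
  tvg_mulx1 : forall x, tvg_mul x tvg_one = [mset x; x];
  tvg_mulxV : forall x, tvg_one \in tvg_mul x (tvg_inv x);
  tvg_mulVx : forall x, tvg_one \in tvg_mul (tvg_inv x) x;
  tvg_inv_uniq : forall x y,
    tvg_one \in tvg_mul x y \/ tvg_one \in tvg_mul y x -> y = tvg_inv x
}.

Arguments tvg_one {_}.
Notation "x * y" := (tvg_mul x y) : two_valued_scope.

Definition tvg_commutative (X : twoValuedGroup) := forall x y : X, x * y = y * x.

Definition tvg_involutive (X : twoValuedGroup) := forall x : X, tvg_inv x = x.

Definition tvg_morphism (X Y : twoValuedGroup) (f : X -> Y) :=
  forall x y z1 z2 : X, x * y = [mset z1; z2] -> f x * f y = [mset f z1; f z2].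

Definition tvg_isomorphic (X Y : twoValuedGroup) :=
  exists f : X -> Y, bijective f /\ tvg_morphism f.

Section Powers.
Variable X : twoValuedGroup.
Implicit Types (x y z : X) (s : nat -> X).

Definition is_powers x s :=
  [/\ s 0 = tvg_one, s 1 = x &
      forall k, 0 < k -> x * s k = [mset s k.-1; s k.+1] /\
                         s k * x = [mset s k.-1; s k.+1]].

(* (x^k, x^(k+1)) is sent to (x^(k+1), x^(k+2)): the element x^(k+2) is what
   remains of x * x^(k+1) once x^k is removed. *)
Definition power_step x (p : X * X) : X * X :=
  (p.2, head tvg_one (enum_mset ((x * p.2) `\ p.1))).

Definition tvg_power x k : X := (iter k (power_step x) (tvg_one, x)).1.

Lemma is_powers_uniq x s s' : is_powers x s -> is_powers x s' -> s =1 s'.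
Proof.
move=> [s0 s1 sS] [s'0 s'1 s'S].
have E k : s k = s' k /\ s k.+1 = s' k.+1.
  elim: k => [|k [IH1 IH2]]; first by rewrite s0 s1.
  split=> //; have [+ _] := sS k.+1 isT; have [+ _] := s'S k.+1 isT.
  rewrite IH2 => -> /= /esym; rewrite IH1 => /(congr1 (fun A => A `\ s' k)).
  by rewrite !msetD1K => /msetP/(_ (s k.+2)); rewrite !msetnE eqxx; case: eqP.
by move=> k; case: (E k).
Qed.

Lemma tvg_mem_cycle x y z : tvg_involutive X -> z \in x * y -> x \in y * z.
Proof.
move=> invX zxy.
have [s [t Exy]] := mset_size2 (tvg_size x y).
have [u [v Eyz]] := mset_size2 (tvg_size y z).
have e1 : tvg_one \in s * z `+` t * z.
  have ezz : tvg_one \in z * z by rewrite -{2}(invX z) tvg_mulxV.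
  move: zxy; rewrite Exy in_mset2 in_msetD => /orP[/eqP<-|/eqP<-];
  by rewrite ezz ?orbT.
move: e1; rewrite -(tvg_mulA Eyz Exy) in_msetD Eyz in_mset2.
by case/orP=> exw; have := tvg_inv_uniq (or_introl exw);
  rewrite invX => ->; rewrite eqxx ?orbT.
Qed.

Lemma tvg_powerP x :
  tvg_involutive X -> tvg_commutative X -> is_powers x (tvg_power x).
Proof.
move=> invX comX.
have S k : tvg_power x k.+1 = (iter k (power_step x) (tvg_one, x)).2 by [].
have SS k : tvg_power x k.+2 =
    head tvg_one (enum_mset ((x * tvg_power x k.+1) `\ tvg_power x k)) by [].
have mem k : tvg_power x k \in x * tvg_power x k.+1 ->
    x * tvg_power x k.+1 = [mset tvg_power x k; tvg_power x k.+2].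
  have [a [b Eab]] := mset_size2 (tvg_size x (tvg_power x k.+1)).
  rewrite SS Eab in_mset2 => /orP[]/eqP->.
    by rewrite msetD1K enum_msetn.
  by rewrite mset2C msetD1K enum_msetn.
have main k : x * tvg_power x k.+1 = [mset tvg_power x k; tvg_power x k.+2].
  elim: k => [|k IH]; apply: mem.
    by rewrite /tvg_power /= -{2}(invX x) tvg_mulxV.
  have : tvg_power x k.+2 \in tvg_power x k.+1 * x by rewrite comX IH mset22.
  by move/(tvg_mem_cycle invX).
by split=> // -[//|k] _; rewrite (comX (tvg_power x _)) main.
Qed.

(* None stands for the infinite order. *)
Definition tvg_ord x : option nat :=
  match pselect (exists k, (0 < k) && (tvg_power x k == tvg_one)) with
  | left ex => Some (ex_minn ex)
  | right _ => None
  end.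

Definition tvg_ord_gt (n : nat) x : bool :=
  if tvg_ord x is Some k then n < k else true.

End Powers.

Definition tvg_special (X : twoValuedGroup) :=
  [/\ tvg_involutive X, tvg_commutative X &
      exists x y : X, [/\ tvg_ord_gt 2 x, tvg_ord_gt 2 y &
                          exists z : X, x * y = [mset z; z]]].

Section Coset.
Local Open Scope group_scope.
Local Open Scope quotient_scope.
Variables (G : groupType) (iota : {multiplicative G -> G}).
Hypothesis iotaK : involutive iota.

Definition iota_orbit : rel G := fun g h => (h == g) || (h == iota g).

Lemma iota_orbit_refl : reflexive iota_orbit.
Proof. by move=> g; rewrite /iota_orbit eqxx. Qed.

Lemma iota_orbit_sym : symmetric iota_orbit.
Proof.
move=> g h; rewrite /iota_orbit eq_sym; congr (_ || _).
by apply/eqP/eqP => ->; rewrite iotaK.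
Qed.

Lemma iota_orbit_trans : transitive iota_orbit.
Proof.
move=> h g k; rewrite /iota_orbit => /orP[]/eqP-> /orP[]/eqP->;
by rewrite ?iotaK eqxx ?orbT.
Qed.

Definition iota_equiv : equiv_rel G :=
  EquivRel iota_orbit iota_orbit_refl iota_orbit_sym iota_orbit_trans.

Definition coset_sort : choiceType := {eq_quot iota_equiv}.

Definition coset_pi (g : G) : coset_sort := \pi_{eq_quot iota_equiv} g.

Definition coset_repr (p : coset_sort) : G := repr (p : {eq_quot iota_equiv}).

Definition coset_mul (p q : coset_sort) : {mset coset_sort} :=
  [mset coset_pi (coset_repr p * coset_repr q);
        coset_pi (coset_repr p * iota (coset_repr q))].

Definition coset_one : coset_sort := coset_pi 1.

Definition coset_inv (p : coset_sort) : coset_sort := coset_pi (coset_repr p)^-1.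

Lemma coset_piP g h : coset_pi g = coset_pi h <-> h = g \/ h = iota g.
Proof.
split=> [/eqmodP/orP[]/eqP|H]; [by left | by right |].
by apply/eqmodP; apply/orP; case: H => ->; rewrite eqxx; [left | right].
Qed.

Lemma coset_pi_iota g : coset_pi (iota g) = coset_pi g.
Proof. by apply/coset_piP; right; rewrite iotaK. Qed.

Lemma coset_piW (P : coset_sort -> Prop) :
  (forall g, P (coset_pi g)) -> forall p, P p.
Proof. exact: quotW. Qed.

Lemma coset_reprP g : coset_repr (coset_pi g) = g \/ coset_repr (coset_pi g) = iota g.
Proof. by apply/coset_piP/esym; exact: reprK. Qed.

Lemma iota1 : iota 1 = 1.
Proof. by apply: (mulgI (iota 1)); rewrite -gmulfM !mulg1. Qed.

Lemma iotaV g : iota g^-1 = (iota g)^-1.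
Proof. by apply: (mulgI (iota g)); rewrite -gmulfM !mulgV iota1. Qed.

Lemma coset_mulE g h :
  coset_mul (coset_pi g) (coset_pi h) = [mset coset_pi (g * h); coset_pi (g * iota h)].
Proof.
have E1 : coset_pi (iota g * h) = coset_pi (g * iota h).
  by rewrite -coset_pi_iota gmulfM iotaK.
have E2 : coset_pi (iota g * iota h) = coset_pi (g * h).
  by rewrite -gmulfM coset_pi_iota.
rewrite /coset_mul; case: (coset_reprP g) => ->; case: (coset_reprP h) => ->;
  by rewrite ?iotaK ?E1 ?E2 // mset2C.
Qed.

Lemma coset_invE g : coset_inv (coset_pi g) = coset_pi g^-1.
Proof.
rewrite /coset_inv; case: (coset_reprP g) => -> //.
by rewrite -iotaV coset_pi_iota.
Qed.

Lemma coset_size p q : size (coset_mul p q) = 2.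
Proof. exact: size_mset2. Qed.

Lemma coset_mulA p q r u v s t :
  coset_mul q r = [mset u; v] -> coset_mul p q = [mset s; t] ->
  coset_mul p u `+` coset_mul p v = coset_mul s r `+` coset_mul t r.
Proof.
elim/coset_piW: p => g; elim/coset_piW: q => h; elim/coset_piW: r => k.
rewrite !coset_mulE => Euv Est.
have -> : coset_mul (coset_pi g) u `+` coset_mul (coset_pi g) v =
  coset_mul (coset_pi g) (coset_pi (h * k)) `+`
  coset_mul (coset_pi g) (coset_pi (h * iota k)).
  by case: (mset2_eq Euv) => -[-> ->] //; exact: msetDC.
have -> : coset_mul s (coset_pi k) `+` coset_mul t (coset_pi k) =
  coset_mul (coset_pi (g * h)) (coset_pi k) `+`
  coset_mul (coset_pi (g * iota h)) (coset_pi k).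
  by case: (mset2_eq Est) => -[-> ->] //; exact: msetDC.
rewrite !coset_mulE !gmulfM !iotaK !mulgA (mset2C (coset_pi (g * iota h * k))).
exact: msetDACA.
Qed.

Lemma coset_mul1x p : coset_mul coset_one p = [mset p; p].
Proof. by elim/coset_piW: p => g; rewrite coset_mulE !mul1g coset_pi_iota. Qed.

Lemma coset_mulx1 p : coset_mul p coset_one = [mset p; p].
Proof. by elim/coset_piW: p => g; rewrite coset_mulE iota1 !mulg1. Qed.

Lemma coset_mulxV p : coset_one \in coset_mul p (coset_inv p).
Proof. by elim/coset_piW: p => g; rewrite coset_invE coset_mulE mulgV mset21. Qed.

Lemma coset_mulVx p : coset_one \in coset_mul (coset_inv p) p.
Proof. by elim/coset_piW: p => g; rewrite coset_invE coset_mulE mulVg mset21. Qed.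

Lemma coset_mul_one_inv p q : coset_one \in coset_mul p q -> q = coset_inv p.
Proof.
elim/coset_piW: p => g; elim/coset_piW: q => h; rewrite coset_mulE coset_invE.
have one x : coset_one = coset_pi x -> x = 1 by move/coset_piP; rewrite iota1; case.
rewrite in_mset2 => /orP[]/eqP/one E.
  by rewrite -(mulKg g h) E mulg1.
by rewrite -(coset_pi_iota h) -(mulKg g (iota h)) E mulg1.
Qed.

Lemma coset_inv_uniq p q :
  coset_one \in coset_mul p q \/ coset_one \in coset_mul q p -> q = coset_inv p.
Proof.
case=> /coset_mul_one_inv //; elim/coset_piW: p => g; elim/coset_piW: q => h.
by move=> ->; rewrite !coset_invE invgK.
Qed.

Definition coset_tvg : twoValuedGroup :=
  TwoValuedGroup coset_size coset_mulA coset_mul1x coset_mulx1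
    coset_mulxV coset_mulVx coset_inv_uniq.

End Coset.

Definition tvg_coset (X : twoValuedGroup) :=
  exists (G : groupType) (iota : {multiplicative G -> G}) (iotaK : involutive iota),
    tvg_isomorphic X (coset_tvg iotaK).

(* Main.v *)
From mathcomp Require Import all_boot.
From mathcomp Require Import finmap multiset.
From mathcomp Require Import boolp.
Require Import Defs.

(** If pi(g) * pi(h) consists of two equal elements, then g or h is fixed by
    iota.  If iota fixes g, then pi(g) * pi(g) also consists of two equal
    elements; in an involutive two-valued group one of them is the identity,
    so pi(g) has order at most 2. *)

Set Implicit Arguments.
Unset Strict Implicit.
Unset Printing Implicit Defensive.
Local Open Scope mset_scope.
Local Open Scope two_valued_scope.

Lemma mset2_diag (K : choiceType) (a b c : K) : [mset a; b] = [mset c; c] -> a = b.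
Proof. by case/mset2_eq => -[<- <-]. Qed.

Lemma ord_le2_of_sqr_diag (X : twoValuedGroup) (x z : X) :
  tvg_involutive X -> x * x = [mset z; z] -> ~~ tvg_ord_gt 2 x.
Proof.
move=> invX xx; have x2 : tvg_power x 2 = tvg_one.
  have : tvg_one \in x * x by rewrite -{2}(invX x) tvg_mulxV.
  (* Membership forces [z = tvg_one]; removing one copy of it from [x * x] leaves [tvg_one] as the
     second power. *)
  by rewrite xx in_mset2 orbb /tvg_power /= xx => /eqP->; rewrite msetD1K enum_msetn.
rewrite /tvg_ord_gt /tvg_ord; case: pselect => [ex|[]]; last first.
  by exists 2; rewrite x2 eqxx.
by case: ex_minnP => k _ min_k; rewrite -leqNgt min_k // x2 eqxx.
Qed.

Section Coset.
Variables (G : groupType) (iota : {multiplicative G -> G}).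
Hypothesis iotaK : involutive iota.

Lemma coset_mul_diag (g h : G) r :
  coset_mul (coset_pi iotaK g) (coset_pi iotaK h) = [mset r; r] ->
  iota g = g \/ iota h = h.
Proof.
(* Equal orbits mean [g * iota h = g * h], where [g] cancels, or [g * iota h = iota g * iota h],
   where [iota h] cancels. *)
rewrite coset_mulE => /mset2_diag/coset_piP[/mulgI|]; first by right.
by rewrite gmulfM => /mulIg; left.
Qed.

Lemma coset_sqr_fixed (g : G) : iota g = g ->
  exists r, coset_mul (coset_pi iotaK g) (coset_pi iotaK g) = [mset r; r].
Proof. by move=> gK; eexists; rewrite coset_mulE gK. Qed.

(** A doubled square pulls back along [f]: if [x * x] is [[mset s; t]], then [f s = f t], hence
    [s = t]. *)
Lemma not_ord_gt2_fixed (X : twoValuedGroup) (f : X -> coset_tvg iotaK) x g :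
  tvg_involutive X -> injective f -> tvg_morphism f ->
  f x = coset_pi iotaK g -> iota g = g -> ~~ tvg_ord_gt 2 x.
Proof.
move=> invX f_inj fM fx /coset_sqr_fixed[r]; rewrite -fx => fxx.
have [s [t xx]] := mset_size2 (tvg_size x x).
have /f_inj st : f s = f t by apply: (@mset2_diag _ _ _ r); rewrite -(fM _ _ _ _ xx).
by apply: (@ord_le2_of_sqr_diag _ _ t) => //; rewrite xx st.
Qed.

End Coset.

Theorem proposition4p4 (X : twoValuedGroup) (specialX : tvg_special X) :
  ~ tvg_coset X.
Proof.
case: specialX => invX _ [x [y [x_gt2 y_gt2 [z xy]]]].
case=> G [iota [iotaK [f [/bij_inj f_inj fM]]]].
have [g fx] : exists g, f x = coset_pi iotaK g.
  by elim/coset_piW: (f x) => g; exists g.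
have [h fy] : exists h, f y = coset_pi iotaK h.
  by elim/coset_piW: (f y) => h; exists h.
(* The image of [x * y] is [f z] taken twice, so [iota] fixes [g] or [h]. *)
have := fM _ _ _ _ xy; rewrite fx fy => /coset_mul_diag[gK|hK].
  by have /negP := not_ord_gt2_fixed invX f_inj fM fx gK.
by have /negP := not_ord_gt2_fixed invX f_inj fM fy hK.
Qed.
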